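(* Let $X$ be a Banach space and let $C$ be a norm bounded subset of the dual $X^*$. Suppose that $(C,\gamma)$ is a complete pseudometric space having the weak$^*$-uniform separation property in $X^*$. Let $f: C \to \mathbb{R}\cup\{+\infty\}$ be any proper bounded from below function. Then there exists a $\sigma$-porous subset $F$ of $X$ such that for every $x\in X\setminus F$, the function $f+\hat{x}$ attains $\gamma$-strongly-directionally its infimum over $C$ at some direction $u\in C$.
   Context: Banach spaces are real. $B_X$ is the closed unit ball of $X$. For $x\in X$, $\hat{x}$ denotes the evaluation map $x^*\mapsto \langle x^*,x\rangle$ on $X^*$. A function is proper if it is not identically $+\infty$. Pseudometric: for a nonempty set $C$, a map $\gamma:C\times C\to\mathbb{R}^+=[0,\infty)$ with $\gamma(x,x)=0$, $\gamma(x,y)=\gamma(y,x)$ and $\gamma(x,y)\le\gamma(x,z)+\gamma(z,y)$ for all $x,y,z\in C$ (distinct points may be at distance $0$). Put $x\sim y$ iff $\gamma(x,y)=0$; $(C,\gamma)$ is complete if the quotient $C/\!\sim$ with the induced metric is a complete metric space. No relation between $\gamma$ and the norm of $X^*$ is assumed. Weak$^*$-uniform separation property ($w^*\mathcal{USP}$): for $C\subset X^*$ and a pseudometric space $(C,\gamma)$, we say $(C,\gamma)$ has the $w^*\mathcal{USP}$ in $X^*$ if there exists $a>0$ such that for every $\varepsilon\in\,]0,a]$ there exists $\varpi_C(\varepsilon)>0$ such that for every $p\in C$ there exists $x_{p,\varepsilon}\in B_X$ with $$\langle p,x_{p,\varepsilon}\rangle-\varpi_C(\varepsilon)\ge\langle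 q,x_{p,\varepsilon}\rangle\quad\text{for all } q\in C \text{ with } \gamma(q,p)\ge\varepsilon.$$ Strongly directional infimum: a proper bounded from below function $g:C\to\mathbb{R}\cup\{+\infty\}$ attains $\gamma$-strongly-directionally its infimum over $C$ at a direction $u\in C$ if for every sequence $(q_n)\subset C$, $\lim_n g(q_n)=\inf_C g$ implies $\lim_n\gamma(q_n,u)=0$. (It is not required that $g(u)=\inf_C g$.) $\sigma$-porosity: a subset $A$ of a metric space $M$ is porous in $M$ if there exist $\lambda_0\in(0,1]$ and $r_0>0$ such that for any $x\in M$ and $r\in(0,r_0]$ there exists $y\in M$ such that $\mathring{B}(y;\lambda_0 r)\subset\mathring{B}(x;r)\cap(M\setminus A)$, where $\mathring{B}(\cdot\,;\cdot)$ denotes open balls of $M$. $A$ is $\sigma$-porous if it is a countable union of porous sets in $M$. *)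

(* Defs.v *)
From HB Require Import structures.
From mathcomp Require Import all_boot all_order all_algebra.
From mathcomp Require Import all_classical all_reals all_analysis.

Set Implicit Arguments.
Unset Strict Implicit.
Unset Printing Implicit Defensive.

Import Order.TTheory GRing.Theory Num.Theory.
Import numFieldNormedType.Exports.

Local Open Scope classical_set_scope.
Local Open Scope ring_scope.

#[short(type="dualType")]
HB.structure Definition ContinuousLinearForm (R : realType)
    (X : normedModType R) :=
  { p of @Continuous X R^o p & @GRing.Linear R X R^o *:%R p }.

Section dual.
Context {R : realType} {X : normedModType R}.

Definition unit_ball : set X := [set x | `|x| <= 1].

(* The supremum is over a nonempty set which is bounded by continuity of p,
   hence the default value 0 of sup on unbounded sets plays no role. *)
Definition dual_norm (p : dualType X) : R :=
  sup [set `|p x| | x in unit_ball].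

Definition dual_bounded (C : set (dualType X)) :=
  exists M : R, forall p, C p -> dual_norm p <= M.

Definition evaluation (x : X) (p : dualType X) : R := p x.

End dual.

Section pseudometric.
Context {R : realType} {T : Type}.

Record pseudometric (gamma : T -> T -> R) : Prop := Pseudometric {
  pseudometric_nonempty : inhabited T;
  pseudometric_ge0 : forall x y, 0 <= gamma x y;
  pseudometric_xx : forall x, gamma x x = 0;
  pseudometric_sym : forall x y, gamma x y = gamma y x;
  pseudometric_triangle : forall x y z, gamma x y <= gamma x z + gamma z y }.

Definition complete_metric (d : T -> T -> R) :=
  forall u : nat -> T,
    (forall e, 0 < e ->
       exists N, forall m n, (N <= m)%N -> (N <= n)%N -> d (u m) (u n) < e) ->
    exists l, d (u n) l @[n --> \oo] --> (0 : R).

End pseudometric.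

Section metric_quotient.
Context {R : realType} {T : Type} (gamma : T -> T -> R).

Definition zero_class (x : T) : set T := [set y | gamma x y = 0].

(* T/~, as the type of the equivalence classes of x ~ y <-> gamma x y = 0 *)
Definition metric_quotient : Type := range zero_class.

Definition quotient_class (x : T) : metric_quotient :=
  exist _ (zero_class x) (mem_set (imageT zero_class x)).

Definition quotient_repr (A : metric_quotient) : T :=
  s2val (cid2 (set_mem (valP A))).

Definition quotient_dist (A B : metric_quotient) : R :=
  gamma (quotient_repr A) (quotient_repr B).

(* quotient_dist does not depend on the choice of representatives. *)
Lemma quotient_distE (x y : T) : pseudometric gamma ->
  quotient_dist (quotient_class x) (quotient_class y) = gamma x y.
Proof.
move=> [_ g0 gxx gC gT].
have reprE z : gamma (quotient_repr (quotient_class z)) z = 0.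
  rewrite /quotient_repr; case: cid2 => t _ /= E.
  have : zero_class z z by exact: gxx.
  by rewrite -E.
have le z t z' t' : gamma z z' = 0 -> gamma t t' = 0 -> gamma z t <= gamma z' t'.
  move=> zz' tt'; rewrite (le_trans (gT _ _ z'))// zz' add0r.
  by rewrite (le_trans (gT _ _ t'))// (gC t') tt' addr0.
by apply/eqP; rewrite eq_le !le// gC.
Qed.

Definition complete_pseudometric :=
  pseudometric gamma /\ complete_metric quotient_dist.

End metric_quotient.

Definition wstar_USP {R : realType} {X : normedModType R}
    (C : set (dualType X)) (gamma : C -> C -> R) :=
  exists2 a : R, 0 < a &
    forall e, 0 < e -> e <= a ->
      exists2 w : R, 0 < w &
        forall p : C, exists2 x : X, unit_ball x &
          forall q : C, e <= gamma q p -> val q x <= val p x - w.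

Section directional_infimum.
Context {R : realType} {T : Type}.
Implicit Type g : T -> \bar R.

Definition proper_fun g := exists x, g x != +oo%E.

(* This forces g to take its values in R `|` {+oo}. *)
Definition bounded_from_below g := exists m : R, forall x, (m%:E <= g x)%E.

Definition attains_strongly_directionally (gamma : T -> T -> R) g (u : T) :=
  [/\ proper_fun g, bounded_from_below g &
    forall q : nat -> T,
      g (q n) @[n --> \oo] --> ereal_inf (range g) ->
      gamma (q n) u @[n --> \oo] --> (0 : R)].

End directional_infimum.

(* Stated with the balls of the library, which in a normed module are the open
   balls of the norm: ball x r = [set y | `|x - y| < r]. *)
Section porosity.
Context {R : realType} {M : pseudoMetricType R}.

Definition porous (A : set M) :=
  exists lambda0 r0 : R, [/\ 0 < lambda0, lambda0 <= 1, 0 < r0 &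
    forall (x : M) (r : R), 0 < r -> r <= r0 ->
      exists y : M, ball y (lambda0 * r) `<=` ball x r `&` ~` A].

Definition sigma_porous (A : set M) :=
  exists2 P : nat -> set M, (forall n, porous (P n)) & A = \bigcup_n P n.

End porosity.

(* Main.v *)
Require Import Defs.
From HB Require Import structures.
From mathcomp Require Import all_boot all_order all_algebra.
From mathcomp Require Import all_classical all_reals all_analysis.
From mathcomp Require Import lra.

(** Call a function [g] on [C] [isolating] at scale [e] when some centre [p]
    beats, by a fixed margin, every point at [gamma]-distance at least [e]
    from [p]; a sequence minimizing [g] is then eventually within [e] of [p].

    Scales tending to [0] give strong directional attainment. Of two centres,
    the one with the smaller value cannot be beaten by the other one, so it lies
    within the other's scale: the centres form a Cauchy sequence, and minimizing
    sequences follow them to their limit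
    ([attains_strongly_directionally_of_isolating]).

    It remains to see that, at one fixed scale [e], the points [x] at which
    [f + x] fails to be isolating form a porous set
    ([porous_not_isolating_perturbation]). Choose [p] almost minimizing
    [f + x], and the vector [z] of the unit ball by which the weak* uniform
    separation property separates [p] from the points [e]-far from it, with a
    gap [w] that does not depend on [p]. Passing from [x] to [x - t z] lowers
    [p] by at least [t w] more than those far points, which makes [p] a centre.
    Since [C] is bounded, the gap survives any further perturbation of norm at
    most a fixed multiple of [t], that is, on a whole ball inside the ball of
    centre [x] and radius [r = 2 t], whose radius is a fixed fraction of [r].

    The exceptional set is the union of these porous sets over the scales
    [a / (n + 1)]. *)

Set Implicit Arguments.
Unset Strict Implicit.
Unset Printing Implicit Defensive.

Import Order.TTheory GRing.Theory Num.Theory.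
Import numFieldNormedType.Exports.

Local Open Scope classical_set_scope.
Local Open Scope ring_scope.

Lemma ler_dual_norm (R : realType) (X : normedModType R) (p : dualType X)
  (x : X) : `|p x| <= dual_norm p * `|x|.
Proof.
have [->|x0] := eqVneq x 0; first by rewrite linear0 !normr0 mulr0.
have nx0 : 0 < `|x| by rewrite normr_gt0.
have /linear_boundedP/pinfty_ex_gt0[M M0 pM] : bounded_near p (nbhs (0 : X)).
  exact/continuous_linear_bounded/cts_fun.
rewrite -ler_pdivrMr//; apply: ub_le_sup.
  exists M => _ [y y1 <-]; rewrite (le_trans (pM y))//.
  by rewrite -[leRHS]mulr1 ler_wpM2l// ltW.
exists (`|x|^-1 *: x).
  by rewrite /unit_ball/= normrZ normfV normr_id mulVf// gt_eqF.
by rewrite linearZ/= normrM normfV normr_id mulrC.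
Qed.

(** Every equivalence class is the class of one of its points, so a limit in
    the quotient provides a limit in the pseudometric space itself. *)
Lemma complete_pseudometric_cvg (R : realType) (T : Type) (gamma : T -> T -> R)
    (u : nat -> T) :
  complete_pseudometric gamma ->
  (forall e, 0 < e ->
     exists N, forall m n, (N <= m)%N -> (N <= n)%N -> gamma (u m) (u n) < e) ->
  exists l, gamma (u n) l @[n --> \oo] --> (0 : R).
Proof.
move=> [pg cg] cu.
have [e /cu[N uN]|L uL] := cg (fun n => quotient_class gamma (u n)).
  by exists N => m n Nm Nn; rewrite quotient_distE//; exact: uN.
have [l _ lL] := set_mem (valP L); exists l.
have LE : L = quotient_class gamma l by apply: val_inj; rewrite /= lL.
rewrite LE in uL; apply: cvg_trans uL.
by under eq_fun do rewrite -(quotient_distE _ _ pg).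
Qed.

(** The condition compares [g] with its value at [p] rather than with its
    infimum: this is what makes two centres comparable with each other, and it
    forces every sequence minimizing [g] to end up within [e] of [p]. *)
Definition isolating (R : realType) (T : Type) (gamma : T -> T -> R)
    (g : T -> \bar R) (e : R) :=
  exists p d, [/\ 0 < d, g p \is a fin_num &
    forall q, e <= gamma q p -> (g p + d%:E <= g q)%E].

(** If [g (p k) <= g (p m)] then [p k] is not beaten by [p m], hence lies within
    [e m] of it: the centres form a Cauchy sequence, and their limit is the
    direction of attainment. *)
Lemma attains_strongly_directionally_of_isolating (R : realType) (T : Type)
    (gamma : T -> T -> R) (g : T -> \bar R) (e : nat -> R) :
  complete_pseudometric gamma -> proper_fun g -> bounded_from_below g ->
  e n @[n --> \oo] --> (0 : R) -> (forall n, isolating gamma g (e n)) ->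
  exists u, attains_strongly_directionally gamma g u.
Proof.
move=> cg pg bg e0 /choice[p] /choice[d pd].
have [[_ g0 _ gC gT] _] := cg.
have close k q : (g q < g (p k) + (d k)%:E)%E -> gamma q (p k) < e k.
  have [_ _ far] := pd k.
  by rewrite !ltNge; apply: contra => /far.
have above k : (g (p k) < g (p k) + (d k)%:E)%E.
  by have [dk0 fk _] := pd k; rewrite lteDl.
have le_centre k m : (g (p k) <= g (p m))%E -> gamma (p k) (p m) < e m.
  by move=> km; apply: close; exact: le_lt_trans (above m).
have [|u pu] := @complete_pseudometric_cvg _ _ gamma p cg.
  move=> r r0; have [N _ eN] := cvgr_lt _ e0 _ r0.
  exists N => m n /eN/= emr /eN/= enr.
  have [/le_centre mn|/ltW/le_centre nm] := leP (g (p m)) (g (p n)).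
    exact: lt_trans enr.
  by rewrite gC; exact: lt_trans emr.
exists u; split => // q qinf.
apply/cvgr0Pnorm_lt => r r0.
have r20 : 0 < r / 2 by rewrite divr_gt0.
(* a single centre, close to the limit and of small scale, is enough *)
have [k [ekr pkr]] : exists k, e k < r / 2 /\ gamma (p k) u < r / 2.
  by have [k []] := filter_ex (filterI (cvgr_lt _ e0 _ r20)
    (cvgr_lt _ pu _ r20)); exists k.
have infk : (ereal_inf (range g) < g (p k) + (d k)%:E)%E.
  by apply: le_lt_trans (above k); apply: ereal_inf_lbound; exists (p k).
have qlt := qinf _ (open_nbhs_nbhs (conj (@open_ereal_lt_ereal _ _) infk)).
near=> n; have /close qk : (g (q n) < g (p k) + (d k)%:E)%E by near: n.
by rewrite ger0_norm// (le_lt_trans (gT _ _ (p k)))//; lra.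
Unshelve. all: by end_near.
Qed.

Lemma exists_almost_minimizer (R : realType) (T : Type) (g : T -> \bar R)
    (h : R) :
  proper_fun g -> bounded_from_below g -> 0 < h ->
  exists2 p, g p \is a fin_num & forall q, (g p <= g q + h%:E)%E.
Proof.
move=> [p0 gp0] [m mg] h0.
have mi : (m%:E <= ereal_inf (range g))%E.
  by apply/ereal_infP => _ [q _ <-]; exact: mg.
have ip0 : (ereal_inf (range g) <= g p0)%E.
  by apply: ereal_inf_lbound; exists p0.
have ifin : ereal_inf (range g) \is a fin_num.
  rewrite fin_numE; apply/andP; split.
    by rewrite gt_eqF// (lt_le_trans _ mi)// ltNyr.
  by rewrite lt_eqF// (le_lt_trans ip0)// ltey.
have [_ [p _ <-] pi] := lb_ereal_inf_adherent h0 ifin.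
exists p.
  rewrite fin_numE; apply/andP; split.
    by rewrite gt_eqF// (lt_le_trans _ (mg p))// ltNyr.
  by rewrite lt_eqF// (lt_le_trans pi)// leey.
move=> q; rewrite (le_trans (ltW pi))// leeD2r//.
by apply: ereal_inf_lbound; exists q.
Qed.

Section perturbation.
Context {R : realType} {X : normedModType R} {C : set (dualType X)}
  (f : C -> \bar R).

Definition perturbation (x : X) : C -> \bar R :=
  fun p => (f p + (evaluation x (val p))%:E)%E.

Lemma proper_perturbation x : proper_fun f -> proper_fun (perturbation x).
Proof.
by move=> [p fp]; exists p; rewrite /perturbation; case: (f p) fp.
Qed.

Lemma bounded_below_perturbation K x :
  (forall (p : C) y, `|val p y| <= K * `|y|) ->
  bounded_from_below f -> bounded_from_below (perturbation x).
Proof.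
move=> pK [m mf]; exists (m - K * `|x|) => p.
rewrite EFinD; apply: leeD; first exact: mf.
by rewrite lee_fin lerNl (le_trans (ler_norm _))// normrN; exact: pK.
Qed.

(** In the ball of centre [x] and radius [r], the hole is centred at
    [x - (r / 2) z], where [z] separates an almost minimizer [p] of [f + x] from
    the points [e]-far from it. As [w] and [K] do not depend on [p], the ratio of
    the radii does not depend on [x]. *)
Lemma porous_not_isolating_perturbation (gamma : C -> C -> R) (K e w : R) :
  0 < K -> (forall (p : C) y, `|val p y| <= K * `|y|) ->
  proper_fun f -> bounded_from_below f -> 0 < w ->
  (forall p : C, exists2 z : X, unit_ball z &
     forall q : C, e <= gamma q p -> val q z <= val p z - w) ->
  porous [set x | ~ isolating gamma (perturbation x) e].
Proof.
move=> K0 pK pf bf w0 sep.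
(* l <= 1/2 leaves room for the shift by r/2. The shift gains r w / 2, of which
   almost minimality of p up to r w / 4 leaves r w / 4; the second bound on l
   keeps the error 2 K l r of a further perturbation within r w / 8. *)
pose l := Num.min 2^-1 (w / (16 * K)).
have l0 : 0 < l by rewrite lt_min invr_gt0 ltr0n divr_gt0 ?mulr_gt0.
have l2 : l <= 2^-1 by rewrite ge_min lexx.
have Kl : 16 * (K * l) <= w.
  by rewrite mulrA -ler_pdivlMl ?mulr_gt0// mulrC ge_min lexx orbT.
exists l, 1; split => //; first by rewrite (le_trans l2)//; lra.
move=> x r r0 _.
have [|||p fp ple] := @exists_almost_minimizer _ _ (perturbation x) (r * w / 4).
- exact: proper_perturbation.
- exact: bounded_below_perturbation bf.
- by rewrite divr_gt0 ?mulr_gt0.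
have [z z1 zsep] := sep p.
have r2 : 0 <= r / 2 by rewrite divr_ge0// ltW.
exists (x - (r / 2) *: z) => y; rewrite -ball_normE/= => yz.
set h := y - (x - (r / 2) *: z).
have hlr : `|h| < l * r by rewrite /h distrC.
have yE : y = x - (r / 2) *: z + h by rewrite /h addrC subrK.
have lr : l * r <= 2^-1 * r by rewrite ler_wpM2r// ltW.
split.
  rewrite /= yE opprD addrA opprB addrCA subrr addr0.
  have zr : `|(r / 2) *: z| <= r / 2.
    by rewrite normrZ ger0_norm// ler_piMr.
  by rewrite (le_lt_trans (ler_normB _ _))//; lra.
apply; exists p, (r * w / 8).
have fpf : f p \is a fin_num.
  by move: fp; rewrite /perturbation fin_numD => /andP[].
split; first by rewrite divr_gt0 ?mulr_gt0.
  by rewrite /perturbation fin_numD fpf.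
move=> q /zsep qz; have := ple q; rewrite /perturbation /evaluation.
rewrite -(fineK fpf).
have [m mf] := bf; have := mf q.
case: (f q) => [b _|_ _|]//; last by rewrite addye// leey.
rewrite -!EFinD !lee_fin.
have valy (o : C) : val o y = val o x - (r / 2) * val o z + val o h.
  by rewrite {1}yE linearD linearB linearZ.
rewrite !valy.
have Khr : K * `|h| <= K * (l * r) by rewrite ler_wpM2l// ltW.
have Klr : 16 * (K * (l * r)) <= w * r.
  by rewrite (mulrA K) mulrA ler_wpM2r// ltW.
have zz : (r / 2) * val q z <= (r / 2) * (val p z - w).
  by rewrite ler_wpM2l.
have /ler_normlP[_ ph] := pK p h; have /ler_normlP[qh _] := pK q h.
move: zz; rewrite mulrBr; lra.
Qed.

End perturbation.

Theorem theorem1 (R : realType) (X : completeNormedModType R)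
    (C : set (dualType X)) (gamma : C -> C -> R) (f : C -> \bar R) :
  dual_bounded C ->
  complete_pseudometric gamma ->
  wstar_USP gamma ->
  proper_fun f ->
  bounded_from_below f ->
  exists2 F : set X, sigma_porous F &
    forall x : X, ~ F x ->
      exists u : C,
        attains_strongly_directionally gamma
          (fun p : C => f p + (evaluation x (val p))%:E)%E u.
Proof.
move=> [M CM] cg [a a0 usp] pf bf.
(* a positive constant, since the hole ratio of the porosity divides by it *)
have K0 : 0 < `|M| + 1 by rewrite ltr_wpDl.
have pK (p : C) (y : X) : `|val p y| <= (`|M| + 1) * `|y|.
  rewrite (le_trans (ler_dual_norm _ _))// ler_wpM2r//.
  by rewrite (le_trans (CM _ (set_mem (valP p))))// ler_wpDr// ler_norm.
pose e n : R := a / n.+1%:R.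
pose P n := [set x | ~ isolating gamma (perturbation f x) (e n)].
exists (\bigcup_n P n).
  exists P => // n.
  have [||w w0 sep] := usp (e n); first by rewrite divr_gt0.
    by rewrite ler_pdivrMr// ler_peMr ?ler1n// ltW.
  exact: porous_not_isolating_perturbation K0 pK pf bf w0 sep.
move=> x xP.
apply: (@attains_strongly_directionally_of_isolating _ _ _
  (perturbation f x) e) => //.
- exact: proper_perturbation.
- exact: bounded_below_perturbation bf.
- rewrite -[X in _ --> X](mulr0 a); apply: cvgM; first exact: cvg_cst.
  exact: cvg_harmonic.
- by move=> n; apply: contrapT => nx; apply: xP; exists n.
Qed.
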